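(* (i) Let $\varphi:H\to G$ be a hyper group homomorphism between hyper groups with identity sets $\mathbf e_H,\mathbf e_G$. For each $e\in\mathbf e_H$ let $\varphi_e:H_e\to G_{\varphi(e)}$ be the restriction of $\varphi$ to the component group $H_e$, $K_e=\mathrm{Ker}(\varphi_e)$ and $\mathrm{Im}_e=\mathrm{Im}(\varphi_e)$. Then the map $\theta_e:H_e/K_e\to\mathrm{Im}_e$, $h_eK_e\mapsto\varphi_e(h_e)$, is a group isomorphism; that is, $H_e/K_e\cong\mathrm{Im}_e$ for every $e\in\mathbf e_H$. (ii) Let $H$ be a normal sub hyper group of a hyper group $G$, with identity set $\mathbf e_H$. For each $e\in\mathbf e_H$ define $\pi_e:G_e\to G_e/H_e$ by $g_e\mapsto g_eH_e$. Then $\pi_e$ is a surjective homomorphism with $\mathrm{Ker}(\pi_e)=H_e$.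
   Context: Hyper group: Let $(G,* )$ be a semigroup. A subset $\mathbf e\subset G$ is an identity set if (i) $g*e=e*g$ for all $g\in G$, $e\in\mathbf e$; (ii) $\mathbf e=\{e_\lambda:\lambda\in\Lambda\}$ is indexed without repetition by a lattice $(\Lambda,\le)$ and $e_\lambda*e_\mu=e_{\lambda\vee\mu}$; (iii) for each $g\in G$ there is a unique $e_g=e_{\lambda_g}\in\mathbf e$ such that for all $\lambda\in\Lambda$: $e_\lambda*g=g$ if and only if $\lambda\le\lambda_g$. A hyper group $(G,*,\mathbf e)$ is a semigroup with an identity set such that for each $g\in G$ there is $g^{-1}\in G$ with $g*g^{-1}=g^{-1}*g=e_g$. For $e\in\mathbf e$, the component group is $G_e=\{x\in G: e_x=e\}$, a group under $*$ with identity $e$. Sub hyper group of $(G,*,\mathbf e)$: a hyper group $(H,*,\mathbf e_H)$ with $H\subset G$ and $\mathbf e_H\subset\mathbf e$ a sublattice; $H_e=\{h\in H:e_h=e\}$. It is normal if $gH_{e_g}=H_{e_g}g$ for all $g\in G$ with $e_g\in\mathbf e_H$. Hyper group homomorphism $\varphi:(H,\times^1,\mathbf e_H)\to(G,\times^2,\mathbf e_G)$: a map with $\varphi(x\times^1y)=\varphi(x)\times^2\varphi(y)$, $\varphi(\mathbf e_H)\subset\mathbf e_G$, and $\varphi:\mathbf e_H\to\mathbf e_G$ order preserving (for the non-strict lattice orders). It maps $H_e$ into $G_{\varphi(e)}$. $\mathrm{Ker}(\varphi_e)=\{h\in H_e:\varphi(h)\in\mathbf e_G\}$ (equivalently $\varphi(h)=\varphi(e)$).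 *)

(* Defs.v *)
From mathcomp Require Import all_boot all_order.
From mathcomp Require Import all_classical.

Set Implicit Arguments.
Unset Strict Implicit.
Unset Printing Implicit Defensive.

Local Open Scope classical_set_scope.

(* Groups whose elements form a subset of a type. MathComp has no quotients of
   possibly infinite groups; here a quotient is the group of left cosets, each
   coset being a set. *)

Record group_data (T : Type) := GroupData {
  gcar : set T;
  gop : T -> T -> T;
  gunit : T
}.

Record is_group (T : Type) (A : group_data T) : Prop := IsGroup {
  gop_closed : forall x y, gcar A x -> gcar A y -> gcar A (gop A x y);
  gop_assoc : forall x y z, gcar A x -> gcar A y -> gcar A z ->
    gop A x (gop A y z) = gop A (gop A x y) z;
  gunit_in : gcar A (gunit A);
  gunit_l : forall x, gcar A x -> gop A (gunit A) x = x;
  gunit_r : forall x, gcar A x -> gop A x (gunit A) = x;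
  ginverse : forall x, gcar A x ->
    exists2 y, gcar A y & gop A x y = gunit A /\ gop A y x = gunit A
}.

Record is_group_hom (T U : Type) (A : group_data T) (B : group_data U)
    (f : T -> U) : Prop := IsGroupHom {
  ghom_dom : is_group A;
  ghom_cod : is_group B;
  ghom_fun : set_fun (gcar A) (gcar B) f;
  ghom_mul : forall x y, gcar A x -> gcar A y -> f (gop A x y) = gop B (f x) (f y)
}.

Definition is_group_iso (T U : Type) (A : group_data T) (B : group_data U)
    (f : T -> U) : Prop :=
  is_group_hom A B f /\ set_bij (gcar A) (gcar B) f.

Definition group_ker (T U : Type) (A : group_data T) (B : group_data U)
    (f : T -> U) : set T :=
  [set x | gcar A x /\ f x = gunit B].

Definition lcos (T : Type) (op : T -> T -> T) (x : T) (N : set T) : set T :=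
  [set op x y | y in N].

Definition rcos (T : Type) (op : T -> T -> T) (N : set T) (x : T) : set T :=
  [set op y x | y in N].

Definition set_op (T : Type) (op : T -> T -> T) (X Y : set T) : set T :=
  [set op x y | x in X & y in Y].

Definition is_normal_subgroup (T : Type) (A : group_data T) (N : set T) : Prop :=
  [/\ N `<=` gcar A,
      is_group (GroupData N (gop A) (gunit A)) &
      forall x, gcar A x -> lcos (gop A) x N = rcos (gop A) N x].

Definition quotient_group (T : Type) (A : group_data T) (N : set T) :
    group_data (set T) :=
  GroupData [set lcos (gop A) x N | x in gcar A] (set_op (gop A)) N.

Section HyperGroup.
Context {d : Order.disp_t} {L : latticeType d} {G : semigroupType}.
Local Open Scope group_scope.

Definition sublattice (M : set L) : Prop :=
  forall l m, M l -> M m -> M (Order.meet l m) /\ M (Order.join l m).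

(* [eps l] is e_l. The relations below are relative to a subset S of G and to a
   sublattice M of L, so that the same definition serves for hyper groups
   (S and M full) and for their sub hyper groups. *)

(* e is the identity e_g of g *)
Definition identity_of (M : set L) (eps : L -> G) (g e : G) : Prop :=
  exists l, [/\ M l, eps l = e &
    forall m, M m -> eps m * g = g <-> (m <= l)%O].

Record is_identity_set (S : set G) (M : set L) (eps : L -> G) : Prop :=
  IsIdentitySet {
  idset_lattice : sublattice M;
  idset_sub : set_fun M S eps;
  idset_inj : set_inj M eps;
  idset_comm : forall g l, S g -> M l -> g * eps l = eps l * g;
  idset_join : forall l m, M l -> M m -> eps l * eps m = eps (Order.join l m);
  idset_identity : forall g, S g -> exists! e, identity_of M eps g e
}.

Record is_hyper_group_on (S : set G) (M : set L) (eps : L -> G) : Prop :=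
  IsHyperGroupOn {
  hg_closed : forall x y, S x -> S y -> S (x * y);
  hg_idset : is_identity_set S M eps;
  hg_inverse : forall g, S g -> exists2 g', S g' &
    exists e, [/\ identity_of M eps g e, g * g' = e & g' * g = e]
}.

Definition is_hyper_group (eps : L -> G) : Prop :=
  is_hyper_group_on [set: G] [set: L] eps.

Definition component (S : set G) (M : set L) (eps : L -> G) (e : G) : set G :=
  [set x | S x /\ identity_of M eps x e].

Definition component_group (S : set G) (M : set L) (eps : L -> G) (e : G) :
    group_data G :=
  GroupData (component S M eps e) (fun x y => x * y) e.

(* The identity set of S is [eps @` M], a sublattice of [range eps]. *)
Definition is_sub_hyper_group (eps : L -> G) (S : set G) (M : set L) : Prop :=
  is_hyper_group_on S M eps.

Definition is_normal_sub_hyper_group (eps : L -> G) (S : set G) (M : set L) :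
    Prop :=
  is_sub_hyper_group eps S M /\
  forall g e, identity_of [set: L] eps g e -> (eps @` M) e ->
    lcos (fun x y => x * y) g (component S M eps e) =
    rcos (fun x y => x * y) (component S M eps e) g.

(* the order of L transported to the identity set *)
Definition idset_le (eps : L -> G) (e f : G) : Prop :=
  exists l m, [/\ eps l = e, eps m = f & (l <= m)%O].

End HyperGroup.

Section HyperHom.
Context {dH dG : Order.disp_t} {LH : latticeType dH} {LG : latticeType dG}.
Context {H G : semigroupType}.

Record is_hyper_hom (epsH : LH -> H) (epsG : LG -> G)
    (phi : {multiplicative H -> G}) : Prop := IsHyperHom {
  hhom_idset : set_fun (range epsH) (range epsG) phi;
  hhom_le : forall e f, idset_le epsH e f -> idset_le epsG (phi e) (phi f)
}.

Definition hyper_ker (epsH : LH -> H) (epsG : LG -> G)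
    (phi : {multiplicative H -> G}) (e : H) : set H :=
  [set h | component [set: H] [set: LH] epsH e h /\ range epsG (phi h)].

Definition hyper_im (epsH : LH -> H) (phi : {multiplicative H -> G}) (e : H) :
    group_data G :=
  GroupData (phi @` component [set: H] [set: LH] epsH e)
            (fun x y => (x * y)%g) (phi e).

End HyperHom.

(* Main.v *)
Require Import Defs.
From mathcomp Require Import all_boot all_order.
From mathcomp Require Import all_classical.

(** The theorem is ordinary group theory inside each component group, so only
    two things are specific to hyper groups.

    First, membership in the component of [e] is an equational condition: [x]
    belongs to it exactly when [e] fixes [x] and [x] divides [e]
    ([mem_component], [component_inverse]). Indeed [e_m * x = x] multiplied by an
    [x'] with [x * x' = e] becomes [e_m * e = e], which says [m <= l] for
    [e = e_l]. Such a condition is visibly stable under products, under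
    homomorphisms, and under passing from a sub hyper group to the ambient hyper
    group. This makes components into groups ([component_is_group]), sends [H_e]
    into [G_(phi e)] ([hyper_hom_component]) and puts [H_e] inside [G_e]
    ([component_sub]).

    Secondly, an element of the identity set lies in its own component only,
    so that mapping [h] into the identity set and mapping it to [phi e] are the
    same thing ([hyper_kerE]): the kernel of the hyper group homomorphism is the
    kernel of its restriction to a group homomorphism.

    What remains is the first isomorphism theorem ([first_isomorphism]) and the
    canonical projection ([coset_hom], [coset_ker]) for groups carried by
    subsets. The former rests on the fact that the cosets of a kernel are the
    fibres of the homomorphism ([lcos_ker], [rcos_ker]), which gives normality,
    good definition and injectivity all at once. *)

Set Implicit Arguments.
Unset Strict Implicit.
Unset Printing Implicit Defensive.

Local Open Scope classical_set_scope.

(** * Groups carried by a subset of a type *)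

Section GroupData.
Context {T : Type} {A : group_data T}.
Hypothesis gA : is_group A.

Lemma gsolve_l x y : gcar A x -> gcar A y ->
  exists2 z, gcar A z & gop A x z = y.
Proof.
move=> Ax Ay; have [x' Ax' [xx' _]] := ginverse gA Ax.
exists (gop A x' y); first exact: gop_closed.
by rewrite (gop_assoc gA) // xx' (gunit_l gA).
Qed.

Lemma gsolve_r x y : gcar A x -> gcar A y ->
  exists2 z, gcar A z & gop A z x = y.
Proof.
move=> Ax Ay; have [x' Ax' [_ x'x]] := ginverse gA Ax.
exists (gop A y x'); first exact: gop_closed.
by rewrite -(gop_assoc gA) // x'x (gunit_r gA).
Qed.

Lemma gmul_injl x y z : gcar A x -> gcar A y -> gcar A z ->
  gop A x y = gop A x z -> y = z.
Proof.
move=> Ax Ay Az e; have [x' Ax' [_ x'x]] := ginverse gA Ax.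
rewrite -(gunit_l gA Ay) -(gunit_l gA Az) -x'x.
by rewrite -!(gop_assoc gA) // e.
Qed.

Lemma gmul_injr x y z : gcar A x -> gcar A y -> gcar A z ->
  gop A y x = gop A z x -> y = z.
Proof.
move=> Ax Ay Az e; have [x' Ax' [xx' _]] := ginverse gA Ax.
rewrite -(gunit_r gA Ay) -(gunit_r gA Az) -xx'.
by rewrite !(gop_assoc gA) // e.
Qed.

End GroupData.

(** * Quotient groups *)

Section Quotient.
Context {T : Type} {A : group_data T} {N : set T}.
Hypothesis gA : is_group A.
Hypothesis nN : is_normal_subgroup A N.

Let sNA : N `<=` gcar A. Proof. by case: nN. Qed.
Let gN : is_group (GroupData N (gop A) (gunit A)). Proof. by case: nN. Qed.

Lemma lcos_unit : lcos (gop A) (gunit A) N = N.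
Proof.
apply/seteqP; split=> [_ [n Nn <-]|n Nn].
  by rewrite (gunit_l gA) //; exact: sNA.
by exists n => //; rewrite (gunit_l gA) //; exact: sNA.
Qed.

Lemma lcos_self x : gcar A x -> lcos (gop A) x N x.
Proof.
by move=> Ax; exists (gunit A); [exact: (gunit_in gN)|rewrite (gunit_r gA)].
Qed.

Lemma lcos_in x : N x -> lcos (gop A) x N = N.
Proof.
move=> Nx; apply/seteqP; split=> [_ [n Nn <-]|n Nn]; first exact: (gop_closed gN).
by have [m Nm e] := gsolve_l gN Nx Nn; exists m.
Qed.

(** This is where normality enters: in [x n y m] the factor [n] has to be moved
    past [y]. *)
Lemma lcosM x y : gcar A x -> gcar A y ->
  set_op (gop A) (lcos (gop A) x N) (lcos (gop A) y N) =
  lcos (gop A) (gop A x y) N.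
Proof.
move=> Ax Ay; apply/seteqP; split.
- move=> _ [_ [n Nn <-] [_ [m Nm <-] <-]].
  have [An Am] : gcar A n /\ gcar A m by split; exact: sNA.
  have [_ _ /(_ y Ay) normy] := nN.
  have [n' Nn' en'] : lcos (gop A) y N (gop A n y) by rewrite normy; exists n.
  have An' := sNA Nn'.
  exists (gop A n' m); first exact: (gop_closed gN).
  have AM := gop_closed gA.
  rewrite -(gop_assoc gA Ax An (AM _ _ Ay Am)) (gop_assoc gA An Ay Am) -en'.
  rewrite -(gop_assoc gA Ay An' Am).
  by rewrite (gop_assoc gA Ax Ay (AM _ _ An' Am)).
- move=> _ [n Nn <-]; exists x; first exact: lcos_self.
  exists (gop A y n); first by exists n.
  by rewrite (gop_assoc gA) //; exact: sNA.
Qed.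

Lemma quotient_is_group : is_group (quotient_group A N).
Proof.
have AM := gop_closed gA.
split=> /=.
- by move=> _ _ [x Ax <-] [y Ay <-]; exists (gop A x y); rewrite ?lcosM //; exact: AM.
- move=> _ _ _ [x Ax <-] [y Ay <-] [z Az <-].
  rewrite (lcosM Ay Az) (lcosM Ax (AM _ _ Ay Az)) (lcosM Ax Ay).
  by rewrite (lcosM (AM _ _ Ax Ay) Az) (gop_assoc gA).
- by exists (gunit A); [exact: (gunit_in gA)|exact: lcos_unit].
- move=> _ [x Ax <-]; rewrite -{1}lcos_unit (lcosM (gunit_in gA) Ax).
  by rewrite (gunit_l gA).
- move=> _ [x Ax <-]; rewrite -{2}lcos_unit (lcosM Ax (gunit_in gA)).
  by rewrite (gunit_r gA).
- move=> _ [x Ax <-]; have [y Ay [xy yx]] := ginverse gA Ax.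
  exists (lcos (gop A) y N); first by exists y.
  by rewrite (lcosM Ax Ay) (lcosM Ay Ax) xy yx lcos_unit.
Qed.

Lemma coset_hom :
  is_group_hom A (quotient_group A N) (fun x => lcos (gop A) x N).
Proof.
split=> //; first exact: quotient_is_group.
- by move=> x Ax /=; exists x.
- by move=> x y Ax Ay /=; rewrite lcosM.
Qed.

Lemma coset_ker :
  group_ker A (quotient_group A N) (fun x => lcos (gop A) x N) = N.
Proof.
apply/seteqP; split=> [x [Ax /= <-]|x Nx]; first exact: lcos_self.
by split; [exact: sNA|exact: lcos_in].
Qed.

End Quotient.

(** * The first isomorphism theorem *)

Section FirstIsomorphism.
Context {T U : Type} {A : group_data T} {B : group_data U} {f : T -> U}.
Hypothesis hf : is_group_hom A B f.

Let gA : is_group A. Proof. by case: hf. Qed.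
Let gB : is_group B. Proof. by case: hf. Qed.
Let fB x : gcar A x -> gcar B (f x). Proof. exact: (ghom_fun hf). Qed.
Let fM := ghom_mul hf.
Let K := group_ker A B f.

Lemma ghom_unit : f (gunit A) = gunit B.
Proof.
have A1 := gunit_in gA; have Bf1 := fB A1.
apply: (gmul_injl gB Bf1) => //; first exact: (gunit_in gB).
by rewrite -fM // (gunit_l gA) // (gunit_r gB).
Qed.

Lemma lcos_ker x : gcar A x ->
  lcos (gop A) x K = [set y | gcar A y /\ f y = f x].
Proof.
move=> Ax; apply/seteqP; split.
- move=> _ [k [Ak fk] <-]; split; first exact: (gop_closed gA).
  by rewrite fM // fk (gunit_r gB) //; exact: fB.
- move=> y [Ay fyx]; have [k Ak xk] := gsolve_l gA Ax Ay.
  exists k => //; split=> //; apply: (gmul_injl gB (fB Ax)) => //.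
  + exact: fB.
  + exact: (gunit_in gB).
  + by rewrite -fM // xk fyx (gunit_r gB) //; exact: fB.
Qed.

Lemma rcos_ker x : gcar A x ->
  rcos (gop A) K x = [set y | gcar A y /\ f y = f x].
Proof.
move=> Ax; apply/seteqP; split.
- move=> _ [k [Ak fk] <-]; split; first exact: (gop_closed gA).
  by rewrite fM // fk (gunit_l gB) //; exact: fB.
- move=> y [Ay fyx]; have [k Ak kx] := gsolve_r gA Ax Ay.
  exists k => //; split=> //; apply: (gmul_injr gB (fB Ax)) => //.
  + exact: fB.
  + exact: (gunit_in gB).
  + by rewrite -fM // kx fyx (gunit_l gB) //; exact: fB.
Qed.

Lemma ker_normal : is_normal_subgroup A K.
Proof.
split=> [x []//||x Ax]; last by rewrite lcos_ker ?rcos_ker.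
have B1 := gunit_in gB.
split=> /=.
- move=> x y [Ax fx] [Ay fy]; split; first exact: (gop_closed gA).
  by rewrite fM // fx fy (gunit_l gB).
- by move=> x y z [Ax _] [Ay _] [Az _]; exact: (gop_assoc gA).
- by split; [exact: (gunit_in gA)|exact: ghom_unit].
- by move=> x [Ax _]; exact: (gunit_l gA).
- by move=> x [Ax _]; exact: (gunit_r gA).
- move=> x [Ax fx]; have [y Ay [xy yx]] := ginverse gA Ax; exists y => //.
  by split=> //; rewrite -ghom_unit -xy fM // fx (gunit_l gB) //; exact: fB.
Qed.

Lemma im_is_group : is_group (GroupData (f @` gcar A) (gop B) (gunit B)).
Proof.
split=> /=.
- move=> _ _ [x Ax <-] [y Ay <-]; exists (gop A x y); last exact: fM.
  exact: (gop_closed gA).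
- by move=> _ _ _ [x Ax <-] [y Ay <-] [z Az <-]; apply: (gop_assoc gB); exact: fB.
- by exists (gunit A); [exact: (gunit_in gA)|exact: ghom_unit].
- by move=> _ [x Ax <-]; apply: (gunit_l gB); exact: fB.
- by move=> _ [x Ax <-]; apply: (gunit_r gB); exact: fB.
- move=> _ [x Ax <-]; have [y Ay [xy yx]] := ginverse gA Ax.
  exists (f y); first by exists y.
  by rewrite -!fM // xy yx ghom_unit.
Qed.

Lemma first_isomorphism :
  exists theta : set T -> U,
    (forall x, gcar A x -> theta (lcos (gop A) x K) = f x) /\
    is_group_iso (quotient_group A K)
      (GroupData (f @` gcar A) (gop B) (gunit B)) theta.
Proof.
have eqf x y : gcar A x -> lcos (gop A) x K = lcos (gop A) y K ->
    gcar A y -> f x = f y.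
  move=> Ax + Ay; rewrite (lcos_ker Ay) => e.
  by have : lcos (gop A) x K x := lcos_self gA ker_normal Ax; rewrite e => -[].
have [|theta thetaE] := @choice _ _ (fun X u => forall x,
    gcar A x -> X = lcos (gop A) x K -> u = f x).
  move=> X; case: (pselect (exists2 x, gcar A x & X = lcos (gop A) x K)).
  - by move=> [x Ax ->]; exists (f x) => y Ay e; exact: eqf.
  (* a set that is not a coset may be sent anywhere *)
  - by move=> nX; exists (gunit B) => x Ax e; case: nX; exists x.
have {}thetaE x : gcar A x -> theta (lcos (gop A) x K) = f x.
  by move=> Ax; exact: thetaE.
exists theta; split=> //; split; first split=> /=.
- exact: (quotient_is_group gA ker_normal).
- exact: im_is_group.
- by move=> _ [x Ax <-] /=; rewrite thetaE //; exists x.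
- move=> _ _ [x Ax <-] [y Ay <-].
  by rewrite (lcosM gA ker_normal Ax Ay) !thetaE ?fM //; exact: (gop_closed gA).
- split=> /=.
  + by move=> _ [x Ax <-] /=; rewrite thetaE //; exists x.
  + move=> _ _ /set_mem[x Ax <-] /set_mem[y Ay <-]; rewrite !thetaE // => fxy.
    by rewrite !lcos_ker // fxy.
  + move=> _ [x Ax <-]; exists (lcos (gop A) x K); last exact: thetaE.
    by exists x.
Qed.

End FirstIsomorphism.

(** * Component groups of a hyper group *)

Section Component.
Context {d : Order.disp_t} {L : latticeType d} {G : semigroupType}.
Context {S : set G} {M : set L} {eps : L -> G}.
Hypothesis hg : is_hyper_group_on S M eps.
Local Open Scope group_scope.

Let ids : is_identity_set S M eps := hg_idset hg.

Lemma idset_in l : M l -> S (eps l).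
Proof. exact: (idset_sub ids). Qed.

Lemma idset_absorb l m : M l -> M m -> eps m * eps l = eps l <-> (m <= l)%O.
Proof.
move=> Ml Mm; rewrite (idset_join ids) // Order.JoinTheory.leEjoin.
split=> [e|/eqP-> //]; apply/eqP.
apply: (idset_inj ids _ _ e); rewrite inE //.
by have [] := idset_lattice ids Mm Ml.
Qed.

Lemma identity_of_unique g e f : S g ->
  identity_of M eps g e -> identity_of M eps g f -> e = f.
Proof.
move=> Sg ie jf; have [z [_ u]] := idset_identity ids Sg.
by rewrite -(u e ie) -(u f jf).
Qed.

Lemma identity_of_idset l : M l -> identity_of M eps (eps l) (eps l).
Proof. by move=> Ml; exists l; split=> // m Mm; exact: idset_absorb. Qed.

(** Multiplying [eps m * x = x] on the right by [x'] reduces the question of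
    which [eps m] fix [x] to the same question for [e]. *)
Lemma mem_component l x x' : M l -> S x ->
  eps l * x = x -> x * x' = eps l -> component S M eps (eps l) x.
Proof.
move=> Ml Sx ex xx'; split=> //; exists l; split=> // m Mm; split=> [mx|ml].
- by apply/(idset_absorb Ml Mm); rewrite -xx' mulgA mx.
- by rewrite -ex mulgA (proj2 (idset_absorb Ml Mm) ml).
Qed.

Lemma component_fixl l x : M l -> component S M eps (eps l) x -> eps l * x = x.
Proof. by move=> Ml [Sx [k [Mk <- /(_ k Mk)[_ ->//]]]]. Qed.

Lemma component_fixr l x : M l -> component S M eps (eps l) x -> x * eps l = x.
Proof.
move=> Ml Cx; have [Sx _] := Cx.
by rewrite (idset_comm ids) //; exact: component_fixl.
Qed.

(** The element provided by the definition of a hyper group may lie in a lower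
    component; multiplying it by [eps l] lifts it to the component of [x]. *)
Lemma component_inverse l x : M l -> component S M eps (eps l) x ->
  exists2 x', component S M eps (eps l) x' & x * x' = eps l /\ x' * x = eps l.
Proof.
move=> Ml Cx; have [Sx ix] := Cx.
have [y Sy [e [ie xy yx]]] := hg_inverse hg Sx.
have ee : e = eps l by exact: identity_of_unique ie ix.
rewrite {}ee in ie xy yx.
have idem : eps l * eps l = eps l by apply/(idset_absorb Ml Ml).
have zx : eps l * y * x = eps l by rewrite -mulgA yx idem.
exists (eps l * y); last by split=> //; rewrite mulgA component_fixr.
apply: (mem_component (x' := x)) => //; last by rewrite mulgA idem.
exact: (hg_closed hg (idset_in Ml) Sy).
Qed.

Lemma component_is_group l : M l -> is_group (component_group S M eps (eps l)).
Proof.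
move=> Ml; split=> /=.
- move=> x y Cx Cy.
  have [x' _ [xx' _]] := component_inverse Ml Cx.
  have [y' _ [yy' _]] := component_inverse Ml Cy.
  have [[Sx _] [Sy _]] := (Cx, Cy).
  apply: (mem_component (x' := y' * x')) => //; first exact: (hg_closed hg).
  + by rewrite mulgA component_fixl.
  + by rewrite mulgA -(mulgA x) yy' (component_fixr Ml Cx).
- by move=> x y z _ _ _; rewrite mulgA.
- by split; [exact: idset_in|exact: identity_of_idset].
- by move=> x; exact: component_fixl.
- by move=> x; exact: component_fixr.
- by move=> x; exact: component_inverse.
Qed.

End Component.

(** * Homomorphisms and sub hyper groups on components *)

Section HyperHom.
Context {dH dG : Order.disp_t} {LH : latticeType dH} {LG : latticeType dG}.
Context {H G : semigroupType} {epsH : LH -> H} {epsG : LG -> G}.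
Context {phi : {multiplicative H -> G}}.
Hypothesis hH : is_hyper_group epsH.
Hypothesis hG : is_hyper_group epsG.
Hypothesis hphi : is_hyper_hom epsH epsG phi.
Local Open Scope group_scope.

Lemma hyper_hom_component l h : component setT setT epsH (epsH l) h ->
  component setT setT epsG (phi (epsH l)) (phi h).
Proof.
move=> Ch; have [h' _ [hh' _]] := component_inverse hH (l := l) I Ch.
have [k _ ek] : range epsG (phi (epsH l)) by apply: (hhom_idset hphi); exists l.
rewrite -ek; apply: (mem_component hG (x' := phi h')) => //.
- by rewrite ek -gmulfM (component_fixl (l := l) I Ch).
- by rewrite ek -gmulfM hh'.
Qed.

Lemma hyper_hom_restrict l :
  is_group_hom (component_group setT setT epsH (epsH l))
    (component_group setT setT epsG (phi (epsH l))) phi.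
Proof.
split=> /=.
- exact: component_is_group.
- have [k _ <-] : range epsG (phi (epsH l)) by apply: (hhom_idset hphi); exists l.
  exact: component_is_group.
- by move=> h; exact: hyper_hom_component.
- by move=> x y _ _; exact: gmulfM.
Qed.

Lemma hyper_kerE l :
  hyper_ker epsH epsG phi (epsH l) =
  group_ker (component_group setT setT epsH (epsH l))
    (component_group setT setT epsG (phi (epsH l))) phi.
Proof.
apply/seteqP; split=> h [Ch] /=.
- move=> [k _ ek]; split=> //; rewrite -ek.
  have [_ ih] := hyper_hom_component Ch; rewrite -ek in ih.
  apply: (identity_of_unique hG _ _ ih) => //.
  exact: (identity_of_idset hG (l := k) I).
- by move=> eh; split=> //; rewrite eh; apply: (hhom_idset hphi); exists l.
Qed.

End HyperHom.

(** The index of the identity of [x] is determined by comparison with [M] in the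
    sub hyper group and with all of [L] in the ambient one; that the two agree is
    not formal, and comes from [x] having an inverse. *)
Lemma component_sub {d : Order.disp_t} {L : latticeType d} {G : semigroupType}
    {eps : L -> G} {S : set G} {M : set L} l :
  is_hyper_group eps -> is_sub_hyper_group eps S M -> M l ->
  component S M eps (eps l) `<=` component setT setT eps (eps l).
Proof.
move=> hG hS Ml x Cx; have [x' _ [xx' _]] := component_inverse hS Ml Cx.
by apply: (mem_component hG (x' := x')) => //; exact: component_fixl Ml Cx.
Qed.

Theorem theorem5p7 :
  (forall (dH dG : Order.disp_t) (LH : latticeType dH) (LG : latticeType dG)
      (H G : semigroupType) (epsH : LH -> H) (epsG : LG -> G)
      (phi : {multiplicative H -> G}),
    is_hyper_group epsH -> is_hyper_group epsG -> is_hyper_hom epsH epsG phi ->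
    forall e : H, range epsH e ->
      let He := component_group [set: H] [set: LH] epsH e in
      let Ge := component_group [set: G] [set: LG] epsG (phi e) in
      let Ke := hyper_ker epsH epsG phi e in
      [/\ is_group_hom He Ge phi,
          is_normal_subgroup He Ke &
          exists theta : set H -> G,
            (forall h : H, gcar He h -> theta (lcos (gop He) h Ke) = phi h) /\
            is_group_iso (quotient_group He Ke) (hyper_im epsH phi e) theta])
  /\
  (forall (d : Order.disp_t) (L : latticeType d) (G : semigroupType)
      (eps : L -> G) (H : set G) (LH : set L),
    is_hyper_group eps -> is_normal_sub_hyper_group eps H LH ->
    forall e : G, (eps @` LH) e ->
      let Ge := component_group [set: G] [set: L] eps e in
      let He := component H LH eps e in
      let pi := fun g : G => lcos (gop Ge) g He in
      [/\ is_normal_subgroup Ge He,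
          is_group_hom Ge (quotient_group Ge He) pi,
          set_surj (gcar Ge) (gcar (quotient_group Ge He)) pi &
          group_ker Ge (quotient_group Ge He) pi = He]).
Proof.
split.
- move=> dH dG LH LG H G epsH epsG phi hH hG hphi _ [l _ <-] /=.
  have hom := hyper_hom_restrict hH hG hphi l.
  rewrite (hyper_kerE hH hG hphi); split=> //; first exact: ker_normal hom.
  exact: first_isomorphism hom.
- move=> d L G eps H M hG [hH nH] _ [l Ml <-] /=.
  have gG := component_is_group hG (l := l) I.
  have nHl : is_normal_subgroup (component_group [set: G] [set: L] eps (eps l))
      (component H M eps (eps l)).
    split; first exact: component_sub.
    + exact: (component_is_group hH Ml).
    + by move=> x [_ ix]; apply: nH => //; exists l.
  by split=> //; [exact: coset_hom|exact: coset_ker].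
Qed.
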